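(* Let $\alpha=\alpha_0^{p^s}\in\mathcal{T}_2\setminus\{0\}$, where $\alpha_0\in\mathcal{T}_2$ is such that $x^n-\alpha_0$ is irreducible over $\mathcal{R}_2$. Let $\mathcal{C}$ be an $\alpha$-constacyclic code of length $np^s$ over $\mathcal{R}_2$. Then the Hamming distance $d_H(\mathcal{C})$ is given by the following: (a) If $\mathcal{C}=\{0\}$, then $d_H(\mathcal{C})=0$. (b) If $\mathcal{C}=\langle1\rangle$, then $d_H(\mathcal{C})=1$. (c) If $\mathcal{C}=\langle\gamma(x^n-\alpha_0)^\tau\rangle$ is of Type II, then $$d_H(\mathcal{C})=\begin{cases}1&\text{if }\tau=0;\\ \ell+2&\text{if }\ell p^{s-1}+1\le\tau\le(\ell+1)p^{s-1}\text{ with }0\le\ell\le p-2;\\(i+1)p^k&\text{if }p^s-p^{s-k}+(i-1)p^{s-k-1}+1\le\tau\le p^s-p^{s-k}+ip^{s-k-1}\\&\quad\text{with }1\le i\le p-1\text{ and }1\le k\le s-1.\end{cases}$$ (d) If $\mathcal{C}=\langle(x^n-\alpha_0)^\omega+\gamma(x^n-\alpha_0)^tG(x)\rangle$ is of Type III, then $$d_H(\mathcal{C})=\begin{cases}\ell+2&\text{if }\ell p^{s-1}+1\le\kappa\le(\ell+1)p^{s-1}\text{ with }0\le\ell\le p-2;\\(i+1)p^k&\text{if }p^s-p^{s-k}+(i-1)p^{s-k-1}+1\le\kappa\le p^s-p^{s-k}+ip^{s-k-1}\\&\quad\text{with }1\le i\le p-1\text{ and }1\le k\le s-1.\end{cases}$$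 (e) If $\mathcal{C}=\langle(x^n-\alpha_0)^\omega+\gamma(x^n-\alpha_0)^tG(x),\gamma(x^n-\alpha_0)^\mu\rangle$ is of Type IV, then $$d_H(\mathcal{C})=\begin{cases}1&\text{if }\mu=0;\\ \ell+2&\text{if }\ell p^{s-1}+1\le\mu\le(\ell+1)p^{s-1}\text{ with }0\le\ell\le p-2;\\(i+1)p^k&\text{if }p^s-p^{s-k}+(i-1)p^{s-k-1}+1\le\mu\le p^s-p^{s-k}+ip^{s-k-1}\\&\quad\text{with }1\le i\le p-1\text{ and }1\le k\le s-1.\end{cases}$$
   Context: $\mathcal{R}_2$ is a finite commutative chain ring with unity, with maximal ideal $\langle\gamma\rangle$, where $\gamma\neq0$ and $\gamma^2=0$; its residue field has order $p^m$, $p$ prime. $\zeta\in\mathcal{R}_2$ has multiplicative order $p^m-1$ and $\mathcal{T}_2=\{0,1,\zeta,\dots,\zeta^{p^m-2}\}$. $n,s$ are positive integers with $\gcd(n,p)=1$. $\alpha$-constacyclic codes of length $np^s$ over $\mathcal{R}_2$ are identified with ideals of $\mathcal{R}_{\alpha,0}=\mathcal{R}_2[x]/\langle x^{np^s}-\alpha\rangle$, whose elements are represented by polynomials of degree less than $np^s$. The Hamming weight $w_H(c(x))$ is the number of nonzero coefficients of $c(x)$, and $d_H(\mathcal{C})=\min\{w_H(c):c\in\mathcal{C}\setminus\{0\}\}$, with $d_H(\{0\})=0$. Put $f(x)=x^n-\alpha_0$, and let $\mathcal{P}_n(\mathcal{T}_2)$ be the set of polynomials with coefficients in $\mathcal{T}_2$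 that are $0$ or of degree less than $n$. The ideals of $\mathcal{R}_{\alpha,0}$ are: Type I: $\{0\}$, $\langle1\rangle$. Type II: $\langle\gamma f^\tau\rangle$, $0\le\tau<p^s$. Type III: $\langle f^\omega+\gamma f^tG\rangle$, where $0<\omega<p^s$, $0\le t<\kappa$ if $G\neq0$, and $G$ is $0$ or a unit of $\mathcal{R}_{\alpha,0}$ of the form $\sum_{i=0}^{\kappa-t-1}a_i(x)f(x)^i$ with $a_i\in\mathcal{P}_n(\mathcal{T}_2)$. Type IV: $\langle f^\omega+\gamma f^tG,\gamma f^\mu\rangle$, where $0\le\mu<\kappa\le\omega<p^s$, $0\le t<\mu$ if $G\neq0$, and $G$ is $0$ or a unit of $\mathcal{R}_{\alpha,0}$ of the form $\sum_{i=0}^{\mu-t-1}a_i(x)f(x)^i$ with $a_i\in\mathcal{P}_n(\mathcal{T}_2)$. In both types $\kappa$ is the smallest non-negative integer with $\gamma f^\kappa\in\langle f^\omega+\gamma f^tG\rangle$. *)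

(* Defs.v *)
From HB Require Import structures.
From mathcomp Require Import all_boot all_order all_algebra.

Set Implicit Arguments.
Unset Strict Implicit.
Unset Printing Implicit Defensive.

Import GRing.Theory.
Local Open Scope ring_scope.

(* MathComp's [idealr_closed] excludes the unit ideal and [GRing.unit] requires
   decidable inverses, hence the following elementary notions. *)
Section CommutativeRings.
Variable A : comNzRingType.

Definition is_invertible (x : A) : Prop := exists y, x * y = 1.

Definition is_irreducible (x : A) : Prop :=
  [/\ x <> 0, ~ is_invertible x
    & forall y z, x = y * z -> is_invertible y \/ is_invertible z].

End CommutativeRings.

Section FiniteRings.
Variable A : finComNzRingType.

Definition is_ideal (I : {set A}) : Prop :=
  [/\ 0 \in I, {in I &, forall x y, x + y \in I}
    & forall a, {in I, forall x, a * x \in I}].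

Definition ideal1 (g : A) : {set A} := [set a * g | a : A].

Definition ideal2 (g h : A) : {set A} := [set a * g + b * h | a : A, b : A].

Definition is_chain_ring : Prop :=
  forall I J : {set A}, is_ideal I -> is_ideal J -> I \subset J \/ J \subset I.

Definition is_maximal_ideal (M : {set A}) : Prop :=
  [/\ is_ideal M, M <> setT
    & forall I, is_ideal I -> M \subset I -> I = M \/ I = setT].

(* The underlying set of the quotient A / I. *)
Definition cosets (I : {set A}) : {set {set A}} :=
  [set [set a + x | x in I] | a : A].

(* {0, 1, zeta, ..., zeta^(q-2)} *)
Definition teichmuller (q : nat) (zeta : A) : {set A} :=
  0 |: [set zeta ^+ i | i : 'I_q.-1].

(* The size bound encodes "zero or of degree less than n". *)
Definition is_teich_poly (T : {set A}) (n : nat) (a : {poly A}) : Prop :=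
  a \is a polyOver (mem T) /\ (size a <= n)%N.

End FiniteRings.

HB.instance Definition _ (R : finComNzRingType) (h : {poly R}) :=
  Finite.on {poly %/ h}.

(* For monic nonconstant h, the elements of {poly %/ h} are the polynomials of
   degree less than deg h, with multiplication modulo h. *)
Section Codes.
Variables (R : finComNzRingType) (h : {poly R}).
Local Notation Rh := {poly %/ h}.

Definition hamming_weight (c : Rh) : nat :=
  count (fun a => a != 0) (c : {poly R}).

Definition hamming_distance (C : {set Rh}) : nat :=
  if [pick c in C :\ 0] is Some c0
  then hamming_weight [arg min_(c < c0 in C :\ 0%R) hamming_weight c]%N
  else 0%N.

Variables (gamma : R) (f : Rh).

Definition is_kappa (g : Rh) (kappa : nat) : Prop :=
  gamma *: f ^+ kappa \in ideal1 g /\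
  forall j, gamma *: f ^+ j \in ideal1 g -> (kappa <= j)%N.

Definition gen (omega t : nat) (G : Rh) : Rh :=
  f ^+ omega + gamma *: (f ^+ t * G).

(* G is 0 or a unit \sum_(i < d) a_i f^i with all a_i in P_n(T). *)
Definition admissible (T : {set R}) (n d : nat) (G : Rh) : Prop :=
  G = 0 \/
  is_invertible G /\
  exists a : 'I_d -> {poly R},
    (forall i, is_teich_poly T n (a i)) /\
    G = \sum_(i < d) in_qpoly h (a i) * f ^+ i.

(* In the next two definitions q stands for p^s. *)
Definition typeIII (T : {set R}) (n q omega t kappa : nat) (G : Rh) : Prop :=
  [/\ (0 < omega < q)%N, is_kappa (gen omega t G) kappa,
      (G <> 0 -> (t < kappa)%N) & admissible T n (kappa - t) G].

Definition typeIV (T : {set R}) (n q omega t mu kappa : nat) (G : Rh) : Prop :=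
  [/\ [&& (mu < kappa)%N, (kappa <= omega)%N & (omega < q)%N],
      is_kappa (gen omega t G) kappa,
      (G <> 0 -> (t < mu)%N) & admissible T n (mu - t) G].

End Codes.

(* For p prime and s > 0, the ranges below are pairwise disjoint, cover exactly
   0 < e < p^s, and involve no truncated subtraction. *)
Definition distance_formula (p s e d : nat) : Prop :=
  (forall l : nat, l <= p - 2 ->
     l * p ^ (s - 1) + 1 <= e <= (l + 1) * p ^ (s - 1) ->
     d = l + 2)%N /\
  (forall i k : nat, 1 <= i <= p - 1 -> 1 <= k <= s - 1 ->
     p ^ s - p ^ (s - k) + (i - 1) * p ^ (s - k - 1) + 1 <= e
       <= p ^ s - p ^ (s - k) + i * p ^ (s - k - 1) ->
     d = (i + 1) * p ^ k)%N.

(* Main.v *)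
From HB Require Import structures.
Require Import Defs.
From mathcomp Require Import all_boot all_order all_algebra all_field.

(** Let F be the residue field of R, pi the projection, q = p^s and N = n q.
    Since gamma^2 = 0 and the annihilator of gamma is the maximal ideal,
    multiplication by gamma identifies F-polynomials with gamma-multiples of
    R-polynomials, weights included. If c is a nonzero word of a code C, then
    either gamma c is a nonzero word of C, of weight at most that of c, or c is
    itself a multiple of gamma. So the minimum weight of C is the minimum weight
    of the torsion code of all pi(c) with gamma c in C
    ([codeword_residue]), an ideal of F[x] / (x^N - pi(alpha)).

    Over F, which has characteristic p, x^N - pi(alpha) = fbar^q, where
    fbar = x^n - pi(alpha0). This fbar is irreducible: it is separable, as p does
    not divide n, so a proper factorization would be coprime and would lift to R
    by Hensel's lemma, which for gamma^2 = 0 takes a single step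
    ([red_irreducible]). Hence every word of F[x] / fbar^q is a power of fbar up
    to a unit, and the torsion code is generated by fbar^e, where e is the least
    exponent with gamma f^e in C. In the three nontrivial types, e is tau, kappa
    and mu ([typeII_residue_dvd], [kappa_residue_dvd], [typeIV_residue_dvd]).

    It remains to find the minimum weight of the multiples of fbar^e of degree
    less than N. For e = 0 it is 1. Every exponent 0 < e < q lies in exactly one range
        (p^k - 1) p^(t+1) + l p^t < e <= (p^k - 1) p^(t+1) + (l + 1) p^t
    with k + t + 1 = s and l + 1 < p, and there the minimum is p^k (l + 2). The
    power of fbar at the right end of the range reaches it, because
    (x - b)^(j p^u) is a polynomial of degree j in x^(p^u)
    ([weight_expXnsubC_le]). For the lower bound ([weight_ge_constacyclic]) a
    word is split according to the residue of its exponents modulo some M.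
    Divisibility by g(x^M) passes to division of each part by g, and weights
    add up. Modulo n, this replaces fbar by x - b. Modulo p^(t+1), each part
    becomes a scalar multiple of (x - b')^(p^k - 1), all of whose p^k
    coefficients are nonzero, and the factor p^k splits off. Modulo p^t, the
    parts have degree less than p, where a root of multiplicity l forces more
    than l nonzero coefficients ([weight_gt_multiplicity]). *)

Set Implicit Arguments.
Unset Strict Implicit.
Unset Printing Implicit Defensive.

Import GRing.Theory.
Import Pdiv.RingMonic.
Local Open Scope ring_scope.

(** * The residue field of a maximal ideal *)

Section ResidueField.
Variables (R : finComNzRingType) (M : {set R}).
Hypothesis M_max : is_maximal_ideal M.

(** The proof of maximality is an argument so that the ideal structure below,
    which depends on it, can be inferred from the predicate. *)
Definition in_maximal of is_maximal_ideal M : {pred R} := [pred x in M].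
Local Notation I := (in_maximal M_max).

Fact in_maximal_idealr : idealr_closed I.
Proof.
have [[M0 MD Mmul] MneqT _] := M_max; split => //=.
  apply/negP => /= M1; apply: MneqT; apply/setP => x.
  by rewrite inE -[x]mulr1 Mmul.
by move=> a x y /= xM yM; apply: MD => //; apply: Mmul.
Qed.

HB.instance Definition _ := isIdealr.Build R I in_maximal_idealr.

Definition residue_field : predArgType := {ideal_quot I}.
HB.instance Definition _ := GRing.ComNzRing.on residue_field.
HB.instance Definition _ : isCountable residue_field :=
  CanIsCountable (@reprK R {ideal_quot I}).
HB.instance Definition _ : isFinite residue_field :=
  CanIsFinite (@reprK R {ideal_quot I}).

Definition residue : R -> residue_field := \pi_{ideal_quot I}%qT.

Fact residue_is_zmod_morphism : zmod_morphism residue.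
Proof. exact: (rmorphB (\pi_{ideal_quot I}%qT : {rmorphism R -> _})). Qed.

Fact residue_is_monoid_morphism : monoid_morphism residue.
Proof.
by split; [exact: (rmorph1 (\pi_{ideal_quot I}%qT : {rmorphism R -> _}))
  | exact: (rmorphM (\pi_{ideal_quot I}%qT : {rmorphism R -> _}))].
Qed.

HB.instance Definition _ :=
  GRing.isZmodMorphism.Build R residue_field residue residue_is_zmod_morphism.
HB.instance Definition _ :=
  GRing.isMonoidMorphism.Build R residue_field residue
    residue_is_monoid_morphism.

Lemma residue_eq x y : (residue x == residue y) = (x - y \in M).
Proof. by rewrite -[LHS]Quotient.idealrBE. Qed.

Lemma residue_eq0 x : (residue x == 0) = (x \in M).
Proof. by rewrite -(rmorph0 residue) residue_eq subr0. Qed.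

Definition residue_lift (y : residue_field) : R :=
  @repr R {ideal_quot I} y.

Lemma residue_liftK : cancel residue_lift residue.
Proof. exact: reprK. Qed.

Lemma maximal_bezout x : x \notin M -> exists b, 1 - b * x \in M.
Proof.
have [[M0 MD Mmul] _ Mmax] := M_max => xM.
pose J := [set y | [exists b, y - b * x \in M]].
have xJ : x \in J by rewrite inE; apply/existsP; exists 1; rewrite mul1r subrr.
have [| |JM|JT] := Mmax J; last 2 first.
- by move: xM; rewrite -JM xJ.
- by have := in_setT (1 : R); rewrite -JT inE => /existsP.
- split=> [|u v|a u]; rewrite !inE.
  + by apply/existsP; exists 0; rewrite mul0r subrr.
  + move=> /existsP[b bM] /existsP[c cM]; apply/existsP; exists (b + c).
    by rewrite mulrDl opprD addrACA MD.
  + move=> /existsP[b bM]; apply/existsP; exists (a * b).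
    by rewrite -mulrA -mulrBr Mmul.
- apply/subsetP => y yM; rewrite inE; apply/existsP; exists 0.
  by rewrite mul0r subr0.
Qed.

Definition residue_inv (y : residue_field) : residue_field :=
  odflt 0 [pick z : residue_field | z * y == 1].

Fact residue_mulVf y : y != 0 -> residue_inv y * y = 1.
Proof.
rewrite -[y]residue_liftK residue_eq0 => /maximal_bezout [b bM].
rewrite /residue_inv; case: pickP => [z /eqP //|/(_ (residue b))].
by rewrite -rmorphM -(rmorph1 residue) eq_sym residue_eq bM.
Qed.

Fact residue_inv0 : residue_inv 0 = 0.
Proof.
by rewrite /residue_inv; case: pickP => //= z; rewrite mulr0 eq_sym oner_eq0.
Qed.

HB.instance Definition _ :=
  GRing.ComNzRing_isField.Build residue_field residue_mulVf residue_inv0.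

Lemma card_residue_field : #|residue_field| = #|cosets M|.
Proof.
have [[M0 MD Mmul] _ _] := M_max.
pose g (y : residue_field) := [set residue_lift y + x | x in M].
have gE a : [set a + x | x in M] = g (residue a).
  apply/setP => z; have memg b : (z \in [set b + x | x in M]) = (z - b \in M).
    apply/imsetP/idP => [[x xM ->]|zM]; first by rewrite addrC addKr.
    by exists (z - b); rewrite // addrC subrK.
  by rewrite !memg -!residue_eq residue_liftK.
have g_inj : injective g.
  move=> y z /setP /(_ (residue_lift y)).
  rewrite (_ : _ \in g y); last by apply/imsetP; exists 0; rewrite ?addr0.
  move=> /esym/imsetP [x xM E].
  apply/eqP; rewrite -[y]residue_liftK -[z]residue_liftK residue_eq E.
  by rewrite addrC addKr.
rewrite -(card_codom g_inj); apply: eq_card => B.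
apply/codomP/imsetP => [[y ->]|[a _ ->]]; last first.
  by exists (residue a); rewrite gE.
by exists (residue_lift y).
Qed.

Lemma pchar_residue_field p m :
  prime p -> #|cosets M| = (p ^ m)%N -> p \in [pchar residue_field].
Proof.
move=> p_pr cardM.
by apply: (@card_finPcharP residue_field p m); rewrite ?card_residue_field.
Qed.

End ResidueField.

(** The projection is all that is used of the residue field, together with its
    kernel and a set-theoretic section. *)
Lemma residue_field_exists (R : finComNzRingType) (M : {set R}) p m :
    is_maximal_ideal M -> prime p -> #|cosets M| = (p ^ m)%N ->
  exists (F : fieldType) (pi : {rmorphism R -> F}) (lift : F -> R),
    [/\ cancel lift pi, forall x, (pi x == 0) = (x \in M) & p \in [pchar F]].
Proof.
move=> M_max p_pr cardM.
exists (residue_field M_max), (residue M_max), (@residue_lift _ _ M_max).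
split; [exact: residue_liftK | exact: residue_eq0 |].
exact: pchar_residue_field cardM.
Qed.

(** * Weights of polynomials and decimation *)

Section Weight.
Variable R : comNzRingType.
Implicit Types (a b c : {poly R}) (n m : nat).

Definition weight c : nat := count (fun x => x != 0) c.

Lemma weightE n c : (size c <= n)%N -> weight c = (\sum_(i < n) (c`_i != 0)%R)%N.
Proof.
move=> cn; rewrite /weight -sum1_count (big_nth 0) big_mkord big_mkcond /=.
rewrite (big_ord_widen n (fun i => if c`_i != 0 then 1%N else 0%N) cn).
rewrite big_mkcond; apply: eq_bigr => i _; case: ltnP => [_|ci]; first by case: ifP.
by rewrite nth_default ?eqxx.
Qed.

Lemma weight_gt0 c : (0 < weight c)%N = (c != 0).
Proof.
have [->|c0] := eqVneq c 0; first by rewrite /weight polyseq0.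
rewrite /weight -has_count; apply/hasP; exists (lead_coef c).
  by rewrite mem_nth // prednK // size_poly_gt0.
by rewrite lead_coef_eq0.
Qed.

Lemma weight_le_size c : (weight c <= size c)%N.
Proof. exact: count_size. Qed.

Lemma weight_le a b :
  (forall i, b`_i = 0 -> a`_i = 0) -> (weight a <= weight b)%N.
Proof.
move=> ab; rewrite (weightE (leq_maxl (size a) (size b))).
rewrite (weightE (leq_maxr (size a) (size b))).
apply: leq_sum => i _; have [/ab ->|_] := eqVneq b`_i 0; last exact: leq_b1.
by rewrite eqxx.
Qed.

Lemma weight_lt a b i :
    (forall i, b`_i = 0 -> a`_i = 0) -> a`_i = 0 -> b`_i != 0 ->
  (weight a < weight b)%N.
Proof.
move=> ab ai bi; have ilt : (i < maxn (size a) (size b))%N.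
  rewrite leq_max; apply/orP; right; rewrite ltnNge; apply: contra bi => bi.
  by rewrite nth_default.
rewrite (weightE (leq_maxl (size a) (size b))).
rewrite (weightE (leq_maxr (size a) (size b))).
rewrite (bigD1 (Ordinal ilt)) //= [X in (_ < X)%N](bigD1 (Ordinal ilt)) //=.
rewrite ai bi eqxx add0n add1n ltnS; apply: leq_sum => j _.
have [/ab ->|_] := eqVneq b`_j 0; last exact: leq_b1.
by rewrite eqxx.
Qed.

Lemma weightD a b : (weight (a + b)%R <= weight a + weight b)%N.
Proof.
pose n := maxn (size a) (size b).
rewrite (weightE (size_polyD a b)) (weightE (leq_maxl (size a) (size b))).
rewrite (weightE (leq_maxr (size a) (size b))) -big_split; apply: leq_sum => i _ /=.
rewrite coefD; have [->|_] := eqVneq a`_i 0; first by rewrite add0r.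
exact: leq_trans (leq_b1 _) (leq_addr _ _).
Qed.

Lemma weightC (x : R) : weight x%:P = (x != 0).
Proof.
rewrite (@weightE 1) ?size_polyC ?leq_b1 // big_ord1 coefC eqxx //.
Qed.

Lemma weightMXn n c : weight (c * 'X^n) = weight c.
Proof.
have sz : (size (c * 'X^n)%R <= n + size c)%N.
  by rewrite (leq_trans (size_polyMleq _ _)) // size_polyXn addnS /= addnC.
rewrite (weightE sz) (weightE (leqnn _)) big_split_ord /= big1 ?add0n => [|i _].
  by apply: eq_bigr => i _; rewrite coefMXn ltnNge leq_addr addKn.
by rewrite coefMXn ltn_ord eqxx.
Qed.

Lemma weightMX c : weight (c * 'X) = weight c.
Proof. exact: (weightMXn 1). Qed.

Lemma weightMXaddC c (x : R) : weight (c * 'X + x%:P) = (weight c + (x != 0)%R)%N.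
Proof.
rewrite (@weightE (size c).+1); last by rewrite size_MXaddC; case: ifP.
rewrite big_ord_recl /= coefD coefMX coefC eqxx add0r addnC; congr addn.
rewrite (weightE (leqnn _)); apply: eq_bigr => i _.
by rewrite coefD coefMX coefC addr0.
Qed.

Lemma weightM a b : (weight (a * b)%R <= weight a * weight b)%N.
Proof.
elim/poly_ind: a => [|a x IH]; first by rewrite mul0r -[0]/(polyC 0) weightC eqxx.
rewrite weightMXaddC mulrDl mulnDl (leq_trans (weightD _ _)) // leq_add //.
  by rewrite mulrAC weightMX.
have [->|x0] := eqVneq x 0; first by rewrite mul0r -[0]/(polyC 0) weightC eqxx.
by rewrite mul1n; apply: weight_le => i; rewrite coefCM => ->; rewrite mulr0.
Qed.

Lemma weight_comp_Xn n c : (weight (c \Po 'X^n) <= weight c)%N.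
Proof.
elim/poly_ind: c => [|c x IH]; first by rewrite comp_poly0.
rewrite weightMXaddC comp_polyD comp_polyC.
rewrite comp_polyM comp_polyX (leq_trans (weightD _ _)) // leq_add ?weightC //.
by rewrite weightMXn.
Qed.

End Weight.

Section Sections.
Variable R : comNzRingType.
Variable n : nat.
Hypothesis n_gt0 : (0 < n)%N.
Implicit Types (c g : {poly R}) (r m : nat).

(** The coefficients of c at the exponents congruent to r modulo n, so that c
    is the sum over r < n of the x^r (decimate r c)(x^n). The bound [size c] is
    generous but keeps the size independent of r and n. *)
Definition decimate r c : {poly R} := \poly_(i < size c) c`_(i * n + r).

Lemma coef_decimate r c i : (decimate r c)`_i = c`_(i * n + r).
Proof.
rewrite coef_poly; case: ltnP => // ci; rewrite nth_default //.
by rewrite (leq_trans ci) // (leq_trans _ (leq_addr _ _)) // leq_pmulr.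
Qed.

Lemma size_decimate r c m : (size c <= m * n)%N -> (size (decimate r c) <= m)%N.
Proof.
move=> cm; apply/leq_sizeP => j mj; rewrite coef_decimate nth_default //.
by rewrite (leq_trans cm) // (leq_trans _ (leq_addr _ _)) // leq_pmul2r.
Qed.

(** The exponents i n + r with r < n enumerate all exponents once. *)
Lemma weight_decimate c : weight c = (\sum_(r < n) weight (decimate r c))%N.
Proof.
have cm : (size c <= size c * n)%N by rewrite leq_pmulr.
rewrite (weightE cm) -(big_mkord xpredT (fun i => nat_of_bool (c`_i != 0))).
rewrite big_nat_mul big_mkord.
under [RHS]eq_bigr do rewrite (weightE (size_decimate _ cm)).
rewrite exchange_big /=; apply: eq_bigr => i _.
rewrite mulSn addnC -{1}[(i * n)%N]add0n big_addn addKn big_mkord.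
by apply: eq_bigr => r _; rewrite coef_decimate addnC.
Qed.

Lemma decimate_neq0 c : c != 0 -> exists r : 'I_n, decimate r c != 0.
Proof.
rewrite -weight_gt0 weight_decimate => c0; apply/existsP; apply: contraLR c0.
rewrite negb_exists -leqNgt leqn0 => /forallP c0; apply/eqP/big1 => r _.
by apply/eqP; rewrite -leqn0 leqNgt weight_gt0 c0.
Qed.

Lemma decimate_sum c : c = \sum_(r < n) 'X^r * (decimate r c \Po 'X^n).
Proof.
apply/polyP => i; rewrite coef_sum.
have rn : (i %% n < n)%N by rewrite ltn_mod.
rewrite (bigD1 (Ordinal rn)) //= big1 => [|r neq_r].
  rewrite addr0 coefXnM ltnNge leq_mod /= coef_comp_poly_Xn //.
  have iE : (i - i %% n = i %/ n * n)%N by rewrite {1}(divn_eq i n) addnK.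
  by rewrite iE dvdn_mull // mulnK // coef_decimate -divn_eq.
rewrite coefXnM; case: ltnP => // ri; rewrite coef_comp_poly_Xn // -eqn_mod_dvd //.
case: ifP => // /eqP /esym.
rewrite modn_small // => E; case/eqP: neq_r; exact: val_inj.
Qed.

Lemma decimateM r c g : (r < n)%N ->
  decimate r (c * (g \Po 'X^n)) = decimate r c * g.
Proof.
move=> rn; elim/poly_ind: g => [|g x IH].
  rewrite comp_poly0 !mulr0; apply/polyP => i.
  by rewrite coef_decimate !coef0.
apply/polyP => i; rewrite coef_decimate comp_polyD comp_polyM comp_polyX comp_polyC.
rewrite !mulrDr !mulrA !coefD !coefMC coef_decimate coefMXn coefMX -IH coef_decimate.
congr (_ + _); case: i => [|i]; first by rewrite mul0n add0n rn.
by rewrite /= mulSn -addnA ltnNge leq_addr /= addKn.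
Qed.
End Sections.

(** [decimate] is linear over the polynomials in x^n, so common factors that
    are polynomials in x^n survive in every part. *)
Lemma dvdp_decimate (F : fieldType) n r (c g : {poly F}) : (r < n)%N ->
  g \Po 'X^n %| c -> g %| decimate n r c.
Proof.
move=> rn /dvdpP [u ->]; rewrite decimateM ?dvdp_mulIr //.
exact: leq_ltn_trans rn.
Qed.

(** * Multiples of powers of x^n - b in characteristic p *)

Section RepeatedRoot.
Variables (F : fieldType) (p : nat).
Hypothesis pcharFp : p \in [pchar F].
Implicit Types (b : F) (c : {poly F}).

Let p_prime : prime p := pcharf_prime pcharFp.
Let p_gt0 : (0 < p)%N := prime_gt0 p_prime.

Lemma expXnsubC_pchar n b t :
  ('X^n - b%:P) ^+ (p ^ t) = 'X^(n * p ^ t) - (b ^+ (p ^ t))%:P.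
Proof.
have p_nat : [pchar {poly F}].-nat (p ^ t)%N.
  by rewrite pnatX pnatE ?pchar_poly ?pcharFp.
by rewrite exprDn_pchar // exprNn_pchar // -exprM polyC_exp.
Qed.

Lemma comp_XsubC_Xn b n l : (('X - b%:P) ^+ l) \Po 'X^n = ('X^n - b%:P) ^+ l.
Proof. by rewrite rmorphXn /= comp_polyB comp_polyX comp_polyC. Qed.

Lemma expXsubC_pchar b t l :
  ('X - b%:P) ^+ (l * p ^ t) =
  (('X - (b ^+ (p ^ t))%:P) ^+ l) \Po 'X^(p ^ t).
Proof.
by rewrite mulnC exprM -['X]expr1 expXnsubC_pchar mul1n expr1 comp_XsubC_Xn.
Qed.

(** By induction on l: with v the degree of c, the operator x d/dx - v lowers
    the multiplicity of the root b by at most one, and multiplies the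
    coefficient of x^i by i - v. As all exponents are less than p, it erases
    exactly one nonzero coefficient; the result can vanish only if c is a
    monomial, which has no nonzero root. *)
Lemma weight_gt_multiplicity b c l : b != 0 -> c != 0 -> (size c <= p)%N ->
  ('X - b%:P) ^+ l %| c -> (l < weight c)%N.
Proof.
move=> b0; elim: l c => [|l IH] c c0 cp dvd_c; first by rewrite weight_gt0.
pose v := (size c).-1.
pose d := 'X * c^`() - v%:R *: c.
have dE i : d`_i = (i%:R - v%:R) * c`_i.
  rewrite coefB coefXM coefZ coef_deriv mulrBl; case: i => [|i] /=.
    by rewrite mul0r.
  by rewrite !mulr_natl.
have d_le i : c`_i = 0 -> d`_i = 0 by rewrite dE => ->; rewrite mulr0.
have cv0 : c`_v != 0 by rewrite -lead_coefE lead_coef_eq0.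
have vp : (v < p)%N by rewrite prednK // size_poly_gt0.
have lt_dc : (weight d < weight c)%N.
  by apply: (@weight_lt _ _ _ v) => //; rewrite dE subrr mul0r.
have c_b : c.[b] = 0.
  case/dvdpP: dvd_c => u ->.
  by rewrite exprS !hornerM hornerXsubC subrr mul0r mulr0.
have d0 : d != 0.
  apply/eqP => d0; move/eqP: c_b; rewrite (_ : c = c`_v *: 'X^v).
    by rewrite !hornerE mulf_eq0 expf_eq0 (negPf cv0) (negPf b0) andbF.
  apply/polyP => i; rewrite coefZ coefXn.
  have [->|neq_iv] := eqVneq; first by rewrite mulr1.
  rewrite mulr0; have [ip|pi] := ltnP i p; last first.
    by rewrite nth_default // (leq_trans cp).
  have /eqP := dE i; rewrite d0 coef0 eq_sym mulf_eq0 => /orP[|/eqP //].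
  suff /negPf -> : i%:R - v%:R != 0 :> F by [].
  wlog lt_vi : i v vp ip neq_iv {cv0 d dE d_le lt_dc d0} / (v < i)%N => [wl|].
    move: neq_iv; rewrite neq_ltn => /orP[lt_iv|lt_vi].
      by rewrite -opprB oppr_eq0; apply: wl => //; rewrite neq_ltn lt_iv orbT.
    by apply: wl => //; rewrite neq_ltn lt_vi orbT.
  rewrite -natrB ?(ltnW lt_vi) // -(dvdn_pcharf pcharFp).
  rewrite gtnNdvd ?subn_gt0 //.
  exact: leq_ltn_trans (leq_subr _ _) ip.
have d_size : (size d <= p)%N.
  apply/leq_sizeP => i pi; apply: d_le; rewrite nth_default //.
  exact: leq_trans cp pi.
apply: leq_trans lt_dc; rewrite ltnS; apply: IH => //.
have /dvdpP[u cE] := dvd_c; rewrite dvdp_sub //.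
  rewrite dvdp_mull // cE derivM deriv_exp derivXsubC mul1r.
  rewrite dvdp_add //; first by rewrite dvdp_mull // exprSr dvdp_mulr.
  by rewrite -mulr_natl dvdp_mull // dvdp_mull.
rewrite -mul_polyC dvdp_mull // (dvdp_trans _ dvd_c) //.
by rewrite exprSr dvdp_mulr.
Qed.

(** Every part of c modulo p^t has b^(p^t) as a root of multiplicity l, hence
    more than l nonzero coefficients. Two nonzero parts are then enough, since
    2 (l + 1) >= l + 2; if there is only one, the extra factor x - b raises the
    multiplicity of its root to l + 1. *)
Lemma weight_ge_multiplicity b c l t :
  b != 0 -> c != 0 -> (size c <= p * p ^ t)%N ->
  ('X - b%:P) ^+ (l * p ^ t + 1) %| c -> (l + 2 <= weight c)%N.
Proof.
move=> b0 c0 cp dvd_c; pose Q := (p ^ t)%N; pose bQ := b ^+ Q.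
have Q0 : (0 < Q)%N by rewrite expn_gt0 p_gt0.
have bQ0 : bQ != 0 by rewrite expf_neq0.
have dec_p r : (size (decimate Q r c) <= p)%N by exact: size_decimate.
have dec_dvd (r : 'I_Q) : ('X - bQ%:P) ^+ l %| decimate Q r c.
  apply: dvdp_decimate => //; rewrite -expXsubC_pchar (dvdp_trans _ dvd_c) //.
  by rewrite dvdp_exp2l // leq_addr.
have [r0 r0P] := decimate_neq0 Q0 c0.
have dec_wt (r : 'I_Q) : decimate Q r c != 0 -> (l < weight (decimate Q r c))%N.
  by move=> r_n0; apply: (weight_gt_multiplicity bQ0 r_n0).
rewrite (weight_decimate Q0) (bigD1 r0) //=.
have [r /andP[neq_r rP]|dec0] :=
    pickP [pred r : 'I_Q | (r != r0) && (decimate Q r c != 0)].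
  rewrite (bigD1 r) //= addnA (leq_trans _ (leq_addr _ _)) //.
  have := leq_add (dec_wt _ r0P) (dec_wt _ rP).
  by rewrite addSn addnS !addn2; apply: leq_trans; rewrite ltnS ltnS leq_addr.
rewrite (leq_trans _ (leq_addr _ _)) // addn2.
apply: weight_gt_multiplicity bQ0 r0P _ _ => //.
have cE : c = 'X^r0 * (decimate Q r0 c \Po 'X^Q).
  rewrite {1}(decimate_sum Q0 c) (bigD1 r0) //= big1 ?addr0 // => r neq_r.
  have := dec0 r; rewrite /= neq_r /= => /negbFE/eqP ->.
  by rewrite comp_poly0 mulr0.
have /dvdpP[u uE] := dec_dvd r0.
rewrite uE exprS dvdp_mul // dvdp_XsubCl rootE.
move: dvd_c; rewrite cE uE comp_polyM -expXsubC_pchar mulrA addn1 exprS.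
rewrite dvdp_mul2r ?expf_neq0 ?polyXsubC_eq0 // dvdp_XsubCl rootE.
by rewrite !hornerE horner_comp !hornerE mulf_eq0 expf_eq0 (negPf b0) andbF.
Qed.

(** Divide x^(p^k) - b^(p^k) = (x - b)^(p^k) by x - b. Every coefficient up
    to the degree is nonzero, which is what makes this power special. *)
Lemma expXsubC_predpX b k : b != 0 ->
  ('X - b%:P) ^+ (p ^ k - 1) = \poly_(i < p ^ k) b ^+ (p ^ k - 1 - i).
Proof.
move=> b0; have q0 : (0 < p ^ k)%N by rewrite expn_gt0 p_gt0.
apply: (mulfI (negbT (polyXsubC_eq0 b))).
rewrite -exprS subn1 prednK // -['X in LHS]expr1 expXnsubC_pchar mul1n.
rewrite polyC_exp subrXX poly_def; congr (_ * _).
rewrite (reindex_inj rev_ord_inj); apply: eq_bigr => i _ /=.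
have -> : (p ^ k - i.+1 = (p ^ k).-1 - i)%N by rewrite -subn1 subnAC subnS -subn1.
rewrite subKn; first by rewrite -mul_polyC mulrC polyC_exp.
by rewrite -ltnS prednK.
Qed.

Lemma weight_expXsubC_predpX b k x : b != 0 ->
  weight (x%:P * ('X - b%:P) ^+ (p ^ k - 1)) = ((x != 0)%R * p ^ k)%N.
Proof.
move=> b0; rewrite expXsubC_predpX // mul_polyC (@weightE _ (p ^ k)); last first.
  exact: leq_trans (size_scale_leq _ _) (size_poly _ _).
rewrite -[in RHS](card_ord (p ^ k)) mulnC -sum_nat_const.
apply: eq_bigr => i _; rewrite coefZ coef_poly ltn_ord mulf_eq0 expf_eq0.
by rewrite (negPf b0) andbF orbF.
Qed.

(** Write c = d (x - b)^((p^k - 1) p^(t+1)), where d has degree less than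
    p^(t+1). The second factor is (y - b')^(p^k - 1) in y = x^(p^(t+1)), so c
    consists of p^k nonzero multiples of d, shifted so as not to overlap. *)
Lemma weight_ge_multiplicity_predpX b c k l t :
    b != 0 -> c != 0 -> (size c <= p ^ k * p ^ t.+1)%N ->
    ('X - b%:P) ^+ ((p ^ k - 1) * p ^ t.+1 + (l * p ^ t + 1)) %| c ->
  (p ^ k * (l + 2) <= weight c)%N.
Proof.
move=> b0 c0 c_size /dvdpP[u]; pose M := (p ^ t.+1)%N.
have M0 : (0 < M)%N by rewrite expn_gt0 p_gt0.
have k0 : (0 < p ^ k)%N by rewrite expn_gt0 p_gt0.
rewrite addnC exprD mulrA; set d := u * _ => cE.
have d0 : d != 0 by apply: contraNneq c0 => d0; rewrite cE d0 mul0r.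
have d_size : (size d <= M)%N.
  rewrite -(leq_add2r ((p ^ k - 1) * M)) -mulSn -[(_ - 1).+1]addn1 subnK //.
  move: c_size; rewrite cE size_Mmonic ?monic_exp ?monicXsubC //.
  by rewrite size_exp_XsubC addnS.
have d_wt : (l + 2 <= weight d)%N.
  apply: (@weight_ge_multiplicity b d l t b0 d0); first by rewrite -expnS.
  by rewrite dvdp_mulIr.
suff -> : weight c = (p ^ k * weight d)%N by rewrite leq_pmul2l.
rewrite (weight_decimate M0) (@weightE _ M d)  // big_distrr /=.
apply: eq_bigr => r _; rewrite cE expXsubC_pchar decimateM //.
have /size1_polyC -> : (size (decimate M r d) <= 1)%N.
  by rewrite size_decimate // mul1n.
by rewrite coef_decimate // mul0n add0n weight_expXsubC_predpX ?expf_neq0 // mulnC.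
Qed.

Lemma weight_ge_constacyclic n b c e k l t :
    (0 < n)%N -> b != 0 -> c != 0 -> (size c <= n * p ^ (k + t.+1))%N ->
    ('X^n - b%:P) ^+ e %| c ->
    ((p ^ k - 1) * p ^ t.+1 + l * p ^ t < e)%N ->
  (p ^ k * (l + 2) <= weight c)%N.
Proof.
move=> n0 b0 c0 c_size dvd_c le_e; have [r r0] := decimate_neq0 n0 c0.
rewrite (weight_decimate n0) (bigD1 r) //= (leq_trans _ (leq_addr _ _)) //.
apply: (@weight_ge_multiplicity_predpX b _ k l t) => //.
  by rewrite size_decimate // -expnD mulnC.
apply: dvdp_decimate => //; rewrite comp_XsubC_Xn (dvdp_trans _ dvd_c) //.
by rewrite dvdp_exp2l // addnA addn1.
Qed.

(** (x - b)^(j p^u) is a polynomial of degree j in x^(p^u), so it has at most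
    j + 1 nonzero coefficients; weights are submultiplicative. *)
Lemma weight_expXnsubC_le n b k l t :
  (weight (('X^n - b%:P) ^+ ((p ^ k - 1) * p ^ t.+1 + l * p ^ t)) <=
   p ^ k * (l + 1))%N.
Proof.
have wt_exp j u : (weight (('X - b%:P) ^+ (j * p ^ u)) <= j.+1)%N.
  rewrite expXsubC_pchar (leq_trans (weight_comp_Xn _ _)) //.
  by rewrite (leq_trans (weight_le_size _)) // size_exp_XsubC.
rewrite -comp_XsubC_Xn (leq_trans (weight_comp_Xn _ _)) // exprD.
rewrite (leq_trans (weightM _ _)) // leq_mul ?addn1 //.
by rewrite (leq_trans (wt_exp _ _)) // subn1 prednK // expn_gt0 p_gt0.
Qed.

End RepeatedRoot.

(** * Reduction modulo gamma and Hensel lifting *)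

Section SquareZero.
Variables (R : finComNzRingType) (gamma : R).
Hypotheses (gamma_neq0 : gamma <> 0) (gamma_sqr0 : gamma ^+ 2 = 0).
Variables (F : fieldType) (pi : {rmorphism R -> F}) (lift : F -> R).
Hypothesis liftK : cancel lift pi.
Hypothesis pi_ker : forall x, (pi x == 0) = (x \in ideal1 gamma).
Local Notation red := (map_poly pi).
Implicit Types (P Q : {poly R}).

(** An element outside the maximal ideal is invertible modulo gamma, hence
    acts on gamma as a unit. *)
Lemma mul_gamma_eq0 x : (gamma * x == 0) = (pi x == 0).
Proof.
rewrite pi_ker; apply/idP/idP => [/eqP gx|/imsetP[y _ ->]]; last first.
  by rewrite mulrCA -expr2 gamma_sqr0 mulr0.
rewrite -pi_ker; apply: contraT => x0.
have : pi (1 - lift (pi x)^-1 * x) == 0.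
  by rewrite rmorphB rmorphM rmorph1 liftK mulVf ?subrr.
rewrite pi_ker => /imsetP[y _ /eqP].
rewrite subr_eq => /eqP E; case: gamma_neq0.
by rewrite -[LHS]mulr1 E mulrDr mulrCA -expr2 gamma_sqr0 mulr0 add0r mulrCA gx mulr0.
Qed.

Lemma scale_gamma_eq0 P : (gamma *: P == 0) = (red P == 0).
Proof.
apply/eqP/eqP => /polyP E; apply/polyP => i; apply/eqP; have /eqP := E i.
  by rewrite coefZ coef_map !coef0 mul_gamma_eq0.
by rewrite coefZ coef_map !coef0 mul_gamma_eq0.
Qed.

Lemma weight_scale_gamma P : weight (gamma *: P) = weight (red P).
Proof.
have sz : (size (red P) <= size P)%N by exact: size_poly.
rewrite (weightE (size_scale_leq _ _)) (weightE sz); apply: eq_bigr => i _.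
by rewrite coefZ coef_map mul_gamma_eq0.
Qed.

Lemma weight_red_le P : (weight (red P) <= weight P)%N.
Proof.
rewrite -weight_scale_gamma; apply: weight_le => i.
by rewrite coefZ => ->; rewrite mulr0.
Qed.

Lemma red_eq0_scale P : red P = 0 -> exists Q, P = gamma *: Q.
Proof.
move=> P0; pose g x : R := odflt 0 [pick y | x == y * gamma].
exists (\poly_(i < size P) g P`_i); apply/polyP => i.
rewrite coefZ coef_poly; case: ltnP => [_|Pi]; last first.
  by rewrite nth_default ?mulr0.
have : pi P`_i == 0 by rewrite -coef_map P0 coef0.
rewrite pi_ker /g => /imsetP[y _ E]; case: pickP => [z /eqP {1}->|/(_ y)].
  by rewrite mulrC.
by rewrite E eqxx.
Qed.

Definition lift_poly (u : {poly F}) : {poly R} :=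
  \poly_(i < size u) lift u`_i.

Lemma lift_polyK : cancel lift_poly red.
Proof.
move=> u; apply/polyP => i; rewrite coef_map coef_poly.
case: ltnP => [_|ui]; first exact: liftK.
by rewrite raddf0 nth_default.
Qed.

(** One Newton step suffices: if arbitrary lifts of u and v miss P by gamma r,
    correct them by gamma b r and gamma a r, where a u + b v = 1; the second
    order term is a multiple of gamma^2 = 0. *)
Lemma hensel_lift P (u v : {poly F}) : red P = u * v -> coprimep u v ->
  exists G H, [/\ P = G * H, red G = u & red H = v].
Proof.
move=> redP /Bezout_eq1_coprimepP[[a b] /= ab1].
have [|r rE] := @red_eq0_scale (P - lift_poly u * lift_poly v).
  by rewrite rmorphB rmorphM /= !lift_polyK redP subrr.
pose G := lift_poly u + gamma *: (lift_poly b * r).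
pose H := lift_poly v + gamma *: (lift_poly a * r).
have red_gamma Q : red (gamma *: Q) = 0.
  by apply/eqP; rewrite -scale_gamma_eq0 scalerA -expr2 gamma_sqr0 scale0r.
exists G, H; split; last 2 first.
- by rewrite rmorphD /= red_gamma lift_polyK addr0.
- by rewrite rmorphD /= red_gamma lift_polyK addr0.
have : gamma *: (lift_poly u * (lift_poly a * r) +
                 lift_poly b * r * lift_poly v - r) == 0.
  rewrite scale_gamma_eq0 rmorphB rmorphD !rmorphM /= !lift_polyK.
  rewrite mulrAC mulrA -mulrDl [u * a]mulrC ab1 mul1r subrr //.
rewrite scalerBr subr_eq0 => /eqP E; rewrite /G /H mulrDl !mulrDr.
rewrite -!scalerAl -!scalerAr scalerA -expr2 gamma_sqr0 scale0r addr0.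
by rewrite -addrA -scalerDr E -rE addrC subrK.
Qed.

Lemma red_invertible P : is_invertible P -> size (red P) = 1%N.
Proof.
move=> [Q PQ]; apply/eqP; rewrite -dvdp1; apply/dvdpP.
by exists (red Q); rewrite -rmorphM /= mulrC PQ rmorph1.
Qed.

(** Separability makes the two factors of any factorization of the residue
    coprime, so that it lifts, and irreducibility applies upstairs. *)
Lemma red_irreducible P : P \is monic -> is_irreducible P ->
  separable_poly (red P) -> irreducible_poly (red P).
Proof.
move=> P_monic [_ P_ninv P_irr] P_sep.
split=> [|q q_size /dvdpP[u redP]].
  rewrite ltnNge; apply/negP => P_le; apply: P_ninv.
  move: P_le; rewrite size_map_poly_id0; last first.
    by rewrite (monicP P_monic) rmorph1 oner_eq0.
  move=> /size1_polyC PE; exists 1; rewrite mulr1.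
  move/monicP: P_monic; rewrite PE lead_coefC => ->; exact: polyC1.
have uq_cop : coprimep u q by rewrite (separable_coprime P_sep) ?redP.
have [G [H [PE GE HE]]] := hensel_lift redP uq_cop.
have [/red_invertible|/red_invertible] := P_irr _ _ PE; last first.
  by rewrite HE => /eqP; rewrite (negPf q_size).
rewrite GE redP => /eqP; rewrite size_poly_eq1 => u1.
by rewrite -{1}[q]mul1r eqp_mulr // eqp_sym.
Qed.

End SquareZero.

Lemma separable_XnsubC (F : fieldType) n (b : F) :
  (0 < n)%N -> n%:R != 0 :> F -> b != 0 -> separable_poly ('X^n - b%:P).
Proof.
move=> n0 nF b0; rewrite unlock; apply/Bezout_eq1_coprimepP.
exists ((- b^-1)%:P, (b^-1 * n%:R^-1)%:P * 'X) => /=.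
rewrite derivB derivXn derivC subr0 -['X^_ *+ _]mulr_natl -polyC_natr mulrACA.
rewrite -polyCM mulfVK // -exprS prednK // polyCN mulNr -mulrN opprB mulrBr subrK.
by rewrite -polyCM mulVf.
Qed.

(** * Torsion and distance of constacyclic codes *)

Lemma hamming_distanceE (R : finComNzRingType) (h : {poly R})
    (C : {set {poly %/ h}}) d (c0 : {poly %/ h}) :
    c0 \in C -> c0 != 0 -> (hamming_weight c0 <= d)%N ->
    (forall c : {poly %/ h}, c \in C -> c != 0 -> (d <= hamming_weight c)%N) ->
  hamming_distance C = d.
Proof.
move=> c0C c0n0 c0d d_min; have c0D : c0 \in C :\ 0 by rewrite !inE c0n0.
rewrite /hamming_distance; case: pickP => [c1 c1D|/(_ c0)]; last by rewrite c0D.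
case: arg_minnP => // c cD c_min; apply/eqP; rewrite eqn_leq.
rewrite (leq_trans (c_min _ c0D) c0d) /=.
by move: cD; rewrite !inE => /andP[cn0 cC]; apply: d_min.
Qed.

Section Constacyclic.
Variables (R : finComNzRingType) (gamma : R).
Hypotheses (gamma_neq0 : gamma <> 0) (gamma_sqr0 : gamma ^+ 2 = 0).
Variables (F : fieldType) (pi : {rmorphism R -> F}) (lift : F -> R).
Hypothesis liftK : cancel lift pi.
Hypothesis pi_ker : forall x, (pi x == 0) = (x \in ideal1 gamma).
Variables (p n s : nat) (alpha0 : R).
Hypotheses (pcharFp : p \in [pchar F]) (n_gt0 : (0 < n)%N).
Hypothesis alpha0_neq0 : pi alpha0 != 0.

Local Notation red := (map_poly pi).
Local Notation q := (p ^ s)%N.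
Local Notation h := ('X^(n * p ^ s) - (alpha0 ^+ (p ^ s))%:P).
Local Notation f0 := ('X^n - alpha0%:P : {poly R}).
Local Notation f := (in_qpoly h f0).
Local Notation fbar := ('X^n - (pi alpha0)%:P).
Local Notation Rh := {poly %/ h}.

Let scale_eq0 := scale_gamma_eq0 gamma_neq0 gamma_sqr0 liftK pi_ker.

Lemma constacyclic_length_gt0 : (0 < n * q)%N.
Proof. by rewrite muln_gt0 n_gt0 expn_gt0 prime_gt0 ?(pcharf_prime pcharFp). Qed.

Lemma mk_monic_constacyclic : mk_monic h = h.
Proof.
by rewrite /mk_monic size_XnsubC ?ltnS ?monicXnsubC ?constacyclic_length_gt0.
Qed.

Lemma size_modulus : size (mk_monic h) = (n * q).+1.
Proof.
by rewrite mk_monic_constacyclic size_XnsubC ?constacyclic_length_gt0.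
Qed.

Lemma size_codeword (c : Rh) : (size (c : {poly R}) <= n * q)%N.
Proof. by rewrite -ltnS -size_modulus; exact: size_mk_monic. Qed.

Lemma in_qpolyK (c : Rh) : in_qpoly h c = c.
Proof. by apply/val_inj/in_qpoly_small; exact: size_mk_monic. Qed.

Lemma in_qpoly_short (P : {poly R}) :
  (size P <= n * q)%N -> in_qpoly h P = P :> {poly R}.
Proof. by move=> sz; apply: in_qpoly_small; rewrite size_modulus. Qed.

Lemma red_f : red f0 = fbar.
Proof. by rewrite rmorphB /= map_polyXn map_polyC. Qed.

Lemma red_fX i : red (f0 ^+ i) = fbar ^+ i.
Proof. by rewrite rmorphXn /= red_f. Qed.

Lemma red_modulus : red h = fbar ^+ q.
Proof.
by rewrite (expXnsubC_pchar pcharFp) !polyC_exp rmorphB !rmorphXn /= map_polyX map_polyC.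
Qed.

Lemma fbar_neq0 : fbar != 0.
Proof. by rewrite -size_poly_gt0 size_XnsubC. Qed.

Lemma red_in_qpoly (P : {poly R}) : fbar ^+ q %| red P - red (in_qpoly h P).
Proof.
have h_monic : h \is monic by rewrite monicXnsubC ?constacyclic_length_gt0.
rewrite -rmorphB /= mk_monic_constacyclic {1}(rdivp_eq h_monic P) addrK.
by rewrite rmorphM /= red_modulus dvdp_mulIr.
Qed.

(** For j <= q this depends only on the class of c modulo x^N - alpha, because
    fbar^q is the residue of the modulus: it is membership in the ideal of fbar^j
    in F[x] / fbar^q. *)
Definition residue_dvd j (c : Rh) := fbar ^+ j %| red c.

Lemma residue_dvd_in_qpoly j (P : {poly R}) :
  (j <= q)%N -> residue_dvd j (in_qpoly h P) = (fbar ^+ j %| red P).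
Proof.
move=> jq; have dvd_diff := dvdp_trans (dvdp_exp2l fbar jq) (red_in_qpoly P).
by rewrite -[in RHS](subrK (red (in_qpoly h P)) (red P)) dvdp_addr.
Qed.

Lemma residue_dvdM j (a c : Rh) :
  (j <= q)%N -> residue_dvd j c -> residue_dvd j (a * c).
Proof.
move=> jq jc; rewrite -[a]in_qpolyK -[c]in_qpolyK -in_qpolyM.
by rewrite residue_dvd_in_qpoly // rmorphM dvdp_mull.
Qed.

Lemma residue_dvdD j (a c : Rh) :
  residue_dvd j a -> residue_dvd j c -> residue_dvd j (a + c).
Proof. by move=> ja jc; rewrite /residue_dvd rmorphD dvdp_add. Qed.

Lemma residue_dvd_exp i j : (j <= i)%N -> (j <= q)%N -> residue_dvd j (f ^+ i).
Proof.
move=> ji jq; rewrite -rmorphXn residue_dvd_in_qpoly //.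
by rewrite red_fX dvdp_exp2l.
Qed.

Lemma scale_codeword_eq0 (c : Rh) : (gamma *: c == 0) = (red c == 0).
Proof. by rewrite -scale_eq0 -val_eqE. Qed.

Lemma scale_in_qpoly_eq0 (P : {poly R}) :
  fbar ^+ q %| red P -> gamma *: in_qpoly h P = 0.
Proof.
move=> dvd_P; apply/eqP; rewrite scale_codeword_eq0.
move: dvd_P; rewrite -residue_dvd_in_qpoly // /residue_dvd.
apply: contraTT => c0; apply/negP => /(dvdp_leq c0); apply/negP; rewrite -ltnNge.
rewrite (leq_ltn_trans (size_poly _ _)) // (leq_ltn_trans (size_codeword _)) //.
by rewrite (expXnsubC_pchar pcharFp) size_XnsubC ?constacyclic_length_gt0.
Qed.

Let scale_pi_ker := red_eq0_scale pi_ker.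

(** The residue of c is u fbar^v with u coprime to fbar, hence invertible modulo
    fbar^q; w lifts the inverse of u. *)
Lemma associate_power v (c : Rh) : irreducible_poly fbar ->
    residue_dvd v c -> ~~ residue_dvd v.+1 c ->
  exists w : Rh, gamma *: (w * c) = gamma *: f ^+ v.
Proof.
move=> f_irr /dvdpP[u cE]; rewrite /residue_dvd cE exprS.
rewrite dvdp_mul2r ?expf_neq0 ?fbar_neq0 // -irreducible_poly_coprime // => fu.
have /Bezout_eq1_coprimepP[[x y] /= xy1] : coprimep u (fbar ^+ q).
  by rewrite coprimep_expr // coprimep_sym.
exists (in_qpoly h (lift_poly lift x)).
apply/eqP; rewrite -subr_eq0 -scalerBr -[c]in_qpolyK -in_qpolyM -rmorphXn.
rewrite -rmorphB scale_in_qpoly_eq0 // rmorphB rmorphM /= red_fX lift_polyK //.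
have -> : x * red c - fbar ^+ v = fbar ^+ v * (x * u - 1).
  by rewrite mulrBr mulr1 [fbar ^+ v * _]mulrC -mulrA -cE.
by rewrite -xy1 opprD addNKr dvdp_mull // dvdpNr dvdp_mull.
Qed.

(** If the multiplicity v of fbar in the residue of c were less than kappa, then
    gamma f^v would be a multiple of gamma c, against the minimality of kappa. *)
Lemma kappa_residue_dvd (g c : Rh) kappa : irreducible_poly fbar ->
  is_kappa gamma f g kappa -> gamma *: c \in ideal1 g -> residue_dvd kappa c.
Proof.
move=> f_irr [_ kappa_min] /imsetP[a _ cE]; apply: contraT => not_kappa.
have [|[|v] not_v v_min] := ex_minnP (P := fun v => ~~ residue_dvd v c).
- by exists kappa.
- by rewrite /residue_dvd expr0 dvd1p in not_v.
have v_dvd : residue_dvd v c.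
  by apply: contraT => /v_min; rewrite ltnn.
have [w wE] := associate_power f_irr v_dvd not_v.
have /kappa_min : gamma *: f ^+ v \in ideal1 g.
  by rewrite -wE scalerAr cE; apply/imsetP; exists (w * a); rewrite ?mulrA.
by rewrite leqNgt v_min.
Qed.

(** In this section the torsion code of C is generated by fbar^e: [mem_C] puts
    the generator in it, and [dvd_C] says that it contains nothing more. *)
Section Torsion.
Variables (C : {set Rh}) (e : nat).
Hypotheses (C_ideal : is_ideal C) (lt_eq : (e < q)%N).
Hypothesis mem_C : gamma *: f ^+ e \in C.
Hypothesis dvd_C : forall c : Rh, gamma *: c \in C -> residue_dvd e c.

(** Take d = c unless gamma c = 0; in that case c = gamma d for some d, and
    the weight of gamma d is that of the residue of d. *)
Lemma codeword_residue (c : Rh) : c \in C -> c != 0 ->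
  exists d : Rh, [/\ red d != 0, residue_dvd e d
                  & (weight (red d) <= hamming_weight c)%N].
Proof.
have [_ _ Cmul] := C_ideal => cC c0.
have [gc|gc] := eqVneq (gamma *: c) 0; last first.
  exists c; split; first by rewrite -scale_codeword_eq0.
    by apply: dvd_C; rewrite -[c]mul1r scalerAl Cmul.
  exact: (weight_red_le gamma_neq0 gamma_sqr0 liftK pi_ker).
have /scale_pi_ker[d dE] : red c = 0.
  by apply/eqP; rewrite -scale_codeword_eq0 gc.
have cE : c = gamma *: in_qpoly h d by rewrite -in_qpolyZ -dE in_qpolyK.
exists (in_qpoly h d); split.
- by rewrite -scale_codeword_eq0 -cE.
- by apply: dvd_C; rewrite -cE.
- rewrite -(weight_scale_gamma gamma_neq0 gamma_sqr0 liftK pi_ker).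
  by rewrite -poly_of_qpolyZ -cE.
Qed.

(** Below exponent q, the powers of x^n - alpha0 have degree less than N and are
    not affected by the reduction modulo x^N - alpha. *)
Lemma scaled_power i : (i < q)%N ->
  hamming_weight (gamma *: f ^+ i) = weight (fbar ^+ i) /\ gamma *: f ^+ i != 0.
Proof.
move=> iq; have fE : f ^+ i = f0 ^+ i :> {poly R}.
  rewrite -rmorphXn; apply: in_qpoly_short.
  rewrite (leq_trans (size_poly_exp_leq _ _)) // size_XnsubC //=.
  by rewrite ltn_pmul2l.
split; last by rewrite scale_codeword_eq0 fE red_fX expf_neq0 ?fbar_neq0.
rewrite /hamming_weight poly_of_qpolyZ fE -/(weight _).
by rewrite (weight_scale_gamma gamma_neq0 gamma_sqr0 liftK pi_ker) red_fX.
Qed.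

Lemma distance_full : e = 0%N -> hamming_distance C = 1%N.
Proof.
move=> e0; have [hw n0] := scaled_power lt_eq.
apply: hamming_distanceE mem_C n0 _ _; first by rewrite hw e0 expr0 weightC oner_neq0.
by move=> c _ c0; rewrite /hamming_weight -/(weight _) weight_gt0.
Qed.

(** The two families of ranges of the closed formula are the cases k = 0 and
    k > 0 of this one. *)
Lemma distance_range k t l : s = (k + t.+1)%N -> (l.+1 < p)%N ->
    ((p ^ k - 1) * p ^ t.+1 + l * p ^ t < e)%N ->
    (e <= (p ^ k - 1) * p ^ t.+1 + l.+1 * p ^ t)%N ->
  hamming_distance C = (p ^ k * (l + 2))%N.
Proof.
move=> sE lp lt_e e_le; set i := (X in (e <= X)%N) in e_le.
have p_gt0 : (0 < p)%N by rewrite prime_gt0 ?(pcharf_prime pcharFp).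
have iq : (i < q)%N.
  rewrite sE expnD -[X in (_ < X * _)%N](@subnK 1) ?expn_gt0 ?p_gt0 //.
  by rewrite mulnDl mul1n ltn_add2l expnS ltn_pmul2r // expn_gt0 p_gt0.
have [hw n0] := scaled_power iq.
have [_ _ Cmul] := C_ideal.
apply: (@hamming_distanceE _ _ _ _ (gamma *: f ^+ i)) => //.
- by rewrite -(subnK e_le) exprD scalerAr Cmul.
- rewrite hw (leq_trans (weight_expXnsubC_le pcharFp _ _ _ _ _)) //.
  by rewrite addn1 addn2.
move=> c cC c0; have [d [d0 /= dvd_d wt_d]] := codeword_residue cC c0.
apply: leq_trans wt_d.
apply: (weight_ge_constacyclic pcharFp n_gt0 alpha0_neq0 d0 _ dvd_d lt_e).
by rewrite -sE (leq_trans (size_poly _ _)) ?size_codeword.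
Qed.

Lemma distance_formulaP : (0 < s)%N ->
  distance_formula p s e (hamming_distance C).
Proof.
move=> s_gt0; have p_gt1 : (1 < p)%N by rewrite prime_gt1 ?(pcharf_prime pcharFp).
split=> [l lp|i k /andP[i_gt0 ip] /andP[k_gt0 ks]] /andP[lt_e e_le].
  rewrite !addn1 in lt_e e_le; rewrite (@distance_range 0 (s - 1) l) ?mul1n //.
  - by rewrite add0n subn1 prednK.
  - by rewrite -(subnK p_gt1) addn2 !ltnS.
(* Here t = s - k - 1 and l = i - 1. *)
have [lt_ks ks_le] : (k < s)%N /\ (k <= s)%N.
  have lt_ks : (k < s)%N by rewrite -(subnK s_gt0) addn1 ltnS.
  by split => //; exact: ltnW.
have powE : (p ^ s - p ^ (s - k) = (p ^ k - 1) * p ^ (s - k))%N.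
  by rewrite mulnBl mul1n -expnD subnKC.
have tE : (s - k = (s - k - 1).+1)%N by rewrite -[RHS]addn1 subnK // subn_gt0.
move: tE lt_e e_le; rewrite powE; set t := (s - k - 1)%N => tE; rewrite tE addn1.
move=> lt_e e_le; rewrite (@distance_range k t (i - 1)) //.
- by rewrite mulnC -[i in RHS](subnK i_gt0) -addnA.
- by rewrite -tE subnKC.
- by rewrite -[(i - 1).+1]addn1 subnK // -(subnK (ltnW p_gt1)) addn1 ltnS.
- by rewrite -[(i - 1).+1]addn1 subnK.
Qed.

End Torsion.

Lemma residue_dvd_scale_eq j (c d : Rh) :
  gamma *: c = gamma *: d -> residue_dvd j d -> residue_dvd j c.
Proof.
move=> /eqP; rewrite -subr_eq0 -scalerBr scale_codeword_eq0 => /eqP cd jd.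
by rewrite -(subrK d c) residue_dvdD // /residue_dvd cd dvdp0.
Qed.

Lemma scale_gen omega t (G : Rh) :
  gamma *: gen gamma f omega t G = gamma *: f ^+ omega.
Proof. by rewrite /gen scalerDr scalerA -expr2 gamma_sqr0 scale0r addr0. Qed.

(** Multiplication by gamma kills the gamma part of the generator, which leaves
    gamma f^omega in the code. *)
Lemma kappa_le_omega omega t kappa (G : Rh) :
  is_kappa gamma f (gen gamma f omega t G) kappa -> (kappa <= omega)%N.
Proof.
move=> [_]; apply; rewrite -(scale_gen _ t G) -[X in gamma *: X]mul1r scalerAl.
by apply/imsetP; eexists; first by [].
Qed.

Lemma typeII_residue_dvd tau (c : Rh) : (tau <= q)%N ->
  gamma *: c \in ideal1 (gamma *: f ^+ tau) -> residue_dvd tau c.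
Proof.
move=> tau_q /imsetP[a _]; rewrite -scalerAr => /residue_dvd_scale_eq; apply.
by rewrite residue_dvdM // residue_dvd_exp.
Qed.

Lemma typeIV_residue_dvd (g c : Rh) kappa mu : irreducible_poly fbar ->
    is_kappa gamma f g kappa -> (mu <= kappa)%N -> (mu <= q)%N ->
  gamma *: c \in ideal2 g (gamma *: f ^+ mu) -> residue_dvd mu c.
Proof.
move=> f_irr g_kappa mu_kappa mu_q /imset2P[a b _ _ cE].
rewrite -(subrK (b * f ^+ mu) c) residue_dvdD ?residue_dvdM ?residue_dvd_exp //.
have : residue_dvd kappa (c - b * f ^+ mu).
  apply: kappa_residue_dvd f_irr g_kappa _; apply/imsetP; exists a => //.
  by rewrite scalerBr cE -scalerAr addrK.
by apply: dvdp_trans; rewrite dvdp_exp2l.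
Qed.

End Constacyclic.

Lemma ideal1_generator (A : finComNzRingType) (g : A) : g \in ideal1 g.
Proof. by apply/imsetP; exists 1; rewrite ?mul1r. Qed.

Lemma ideal2_generator (A : finComNzRingType) (g k : A) : k \in ideal2 g k.
Proof. by apply/imset2P; exists 0 1; rewrite ?mul1r ?mul0r ?add0r. Qed.

Theorem theorem3p8 (R : finComNzRingType) (p m n s : nat)
  (gamma zeta alpha alpha0 : R)
  (p_prime : prime p)
  (R_chain : is_chain_ring R)
  (gamma_max : is_maximal_ideal (ideal1 gamma))
  (gamma_neq0 : gamma <> 0) (gamma_sqr0 : gamma ^+ 2 = 0)
  (residue_card : #|cosets (ideal1 gamma)| = (p ^ m)%N)
  (zeta_order : (p ^ m - 1)%N.-primitive_root zeta)
  (n_gt0 : (0 < n)%N) (s_gt0 : (0 < s)%N) (coprime_np : coprime n p)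
  (alpha0_T : alpha0 \in teichmuller (p ^ m) zeta)
  (alphaE : alpha = alpha0 ^+ (p ^ s))
  (alpha_T : alpha \in teichmuller (p ^ m) zeta :\ 0)
  (alpha0_irr : is_irreducible ('X^n - alpha0%:P))
  (C : {set {poly %/ 'X^(n * p ^ s) - alpha%:P}})
  (C_ideal : is_ideal C) :
  let T := teichmuller (p ^ m) zeta in
  let f := in_qpoly ('X^(n * p ^ s) - alpha%:P) ('X^n - alpha0%:P) in
  [/\ C = [set 0] -> hamming_distance C = 0%N,
      C = ideal1 1 -> hamming_distance C = 1%N,
      forall tau : nat, (tau < p ^ s)%N ->
        C = ideal1 (gamma *: f ^+ tau) ->
        (tau = 0%N -> hamming_distance C = 1%N) /\
        distance_formula p s tau (hamming_distance C),
      forall (omega t kappa : nat) G, typeIII gamma f T n (p ^ s) omega t kappa G ->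
        C = ideal1 (gen gamma f omega t G) ->
        distance_formula p s kappa (hamming_distance C)
    & forall (omega t mu kappa : nat) G,
        typeIV gamma f T n (p ^ s) omega t mu kappa G ->
        C = ideal2 (gen gamma f omega t G) (gamma *: f ^+ mu) ->
        (mu = 0%N -> hamming_distance C = 1%N) /\
        distance_formula p s mu (hamming_distance C)].
Proof.
subst alpha; have [F [pi [lift [liftK pi_ker pcharFp]]]] :=
  residue_field_exists gamma_max p_prime residue_card.
have pi_zeta : pi zeta != 0.
  apply/eqP => zeta0; have /eqP := congr1 pi (prim_expr_order zeta_order).
  rewrite rmorphXn zeta0 rmorph1 expr0n gtn_eqF ?(prim_order_gt0 zeta_order) //.
  by rewrite eq_sym oner_eq0.
have q_gt0 : (0 < p ^ s)%N by rewrite expn_gt0 prime_gt0.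
have alpha0_neq0 : pi alpha0 != 0.
  have /setU1P[alpha00|/imsetP[i _ ->]] := alpha0_T.
    by move: alpha_T; rewrite alpha00 expr0n gtn_eqF // !inE eqxx.
  by rewrite rmorphXn expf_neq0.
have n_neq0 : n%:R != 0 :> F.
  by rewrite -(dvdn_pcharf pcharFp) -prime_coprime // coprime_sym.
have f_irr : irreducible_poly ('X^n - (pi alpha0)%:P).
  have redf := red_f pi n alpha0; rewrite -redf.
  apply: (red_irreducible gamma_neq0 gamma_sqr0 liftK pi_ker) => //.
    by rewrite monicXnsubC.
  by rewrite redf separable_XnsubC.
have formula := distance_formulaP gamma_neq0 gamma_sqr0 liftK pi_ker pcharFp
  n_gt0 alpha0_neq0 C_ideal.
have full := distance_full gamma_neq0 gamma_sqr0 liftK pi_ker pcharFp n_gt0.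
move=> T f; split.
- move=> C0; rewrite /hamming_distance C0; case: pickP => // c.
  by rewrite !inE andNb.
- move=> C1; apply: (@hamming_distanceE _ _ _ _ 1).
  + by rewrite C1 ideal1_generator.
  + exact: oner_neq0.
  + by rewrite /hamming_weight -/(weight _) weightC oner_neq0.
  + by move=> c _ c0; rewrite /hamming_weight -/(weight _) weight_gt0.
- move=> tau lt_tau CE.
  have tau_C : gamma *: f ^+ tau \in C by rewrite CE ideal1_generator.
  split; first exact: full lt_tau tau_C.
  apply: formula => // c; rewrite CE.
  exact: (typeII_residue_dvd gamma_neq0 gamma_sqr0 liftK pi_ker pcharFp n_gt0
    (ltnW lt_tau)).
- move=> omega t kappa G [/andP[_ lt_omega] g_kappa _ _] CE.
  have lt_kappa := leq_ltn_trans (kappa_le_omega gamma_sqr0 g_kappa) lt_omega.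
  apply: formula => //.
    by rewrite CE; have [] := g_kappa.
  move=> c; rewrite CE.
  exact: (kappa_residue_dvd gamma_neq0 gamma_sqr0 liftK pi_ker pcharFp n_gt0).
- move=> omega t mu kappa G [/and3P[lt_mu le_kappa lt_omega] g_kappa _ _] CE.
  have mu_C : gamma *: f ^+ mu \in C by rewrite CE ideal2_generator.
  have lt_muq : (mu < p ^ s)%N.
    exact: leq_trans lt_mu (leq_trans le_kappa (ltnW lt_omega)).
  split; first exact: full lt_muq mu_C.
  apply: formula => // c; rewrite CE.
  exact: (typeIV_residue_dvd gamma_neq0 gamma_sqr0 liftK pi_ker pcharFp n_gt0
    f_irr g_kappa (ltnW lt_mu) (ltnW lt_muq)).
Qed.
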